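(* There is no quasi-symmetric $(56,15,42)$ design with block intersection numbers $x=3$, $y=6$, and there is no quasi-symmetric $(56,21,24)$ design with block intersection numbers $x=6$, $y=9$.
   Context: A block design with parameters $(v,k,\lambda)$ consists of a set of $v$ points and a family of $k$-element subsets of the point set, called blocks, such that every pair of distinct points is contained in exactly $\lambda$ blocks. A design is quasi-symmetric with intersection numbers $x<y$ if $|B_1\cap B_2|\in\{x,y\}$ for any two blocks $B_1,B_2$ and both values occur. *)

(* Defs.v *)
From HB Require Import structures.
From mathcomp Require Import all_boot.

Set Implicit Arguments.
Unset Strict Implicit.
Unset Printing Implicit Defensive.

(* The point set is the finite type [T]. The family of blocks is indexed by
   the finite type [I], so repeated blocks are allowed, and blocks are
   counted with multiplicity. *)
Definition block_design (v k lambda : nat) (T I : finType)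
    (B : I -> {set T}) : Prop :=
  [/\ #|T| = v,
      forall i : I, #|B i| = k
    & forall p q : T, p != q ->
        #|[set i : I | (p \in B i) && (q \in B i)]| = lambda].

(* "Two blocks" means two distinct members [i != j] of the family: a repeated
   block would meet its copy in [k] points. *)
Definition quasi_symmetric_design (v k lambda x y : nat) (T I : finType)
    (B : I -> {set T}) : Prop :=
  [/\ block_design v k lambda B,
      x < y,
      forall i j : I, i != j ->
        #|B i :&: B j| = x \/ #|B i :&: B j| = y,
      exists i j : I, i != j /\ #|B i :&: B j| = x
    & exists i j : I, i != j /\ #|B i :&: B j| = y].

(* Main.v *)
Require Import Defs.
From HB Require Import structures.
From mathcomp Require Import all_boot.
From mathcomp Require Import all_algebra zify.

Set Implicit Arguments.
Unset Strict Implicit.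
Unset Printing Implicit Defensive.

Import GRing.Theory.

(** In both designs 3 divides the block size and both intersection numbers, so
    modulo 3 any two blocks, equal or not, are orthogonal, and every block is
    orthogonal to the all-one vector. As 56 is not divisible by 3, the all-one
    vector is not isotropic. Let [N] be the incidence matrix of points against
    blocks and [d] its rank over the field with 3 elements. The row space of
    the blocks is a self-orthogonal code inside a nondegenerate hyperplane of a
    space of dimension 56, which forces [d <= 27]
    ([rank_self_orthogonal_in_hyperplane]).

    On the other hand a small rank modulo 3 makes [\det (N *m N^T)] very
    divisible by 3: it is a multiple of [3 ^ (2 * (56 - d))], hence of [3 ^ 58]
    ([dvdz_det_gram]). But [N *m N^T] has the replication number [r] on its
    diagonal and [lambda] elsewhere, so that its determinant is
    [(r - lambda) ^ 55 * (r + 55 * lambda)] ([det_scalar_plus_const]). With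
    [(r, lambda) = (165, 42)] the two factors are [(3 * 41) ^ 55] and
    [9 * 275]; with [(r, lambda) = (66, 24)] they are [(3 * 14) ^ 55] and
    [9 * 154]. In both cases 3 divides the determinant exactly 57 times. *)

Local Open Scope ring_scope.

(** The code [C] is orthogonal to the span of [C] and [u]. That span is
    strictly larger than [C], since [u] is not orthogonal to itself whereas
    every vector of [C] is; hence [\rank C + (\rank C + 1) <= v]. *)
Lemma rank_self_orthogonal_in_hyperplane (F : fieldType) (b v : nat)
    (C : 'M[F]_(b, v)) (u : 'rV[F]_v) :
  C *m C^T = 0 -> C *m u^T = 0 -> u *m u^T != 0 ->
  ((\rank C).*2 < v)%N.
Proof.
move=> CC0 Cu0 uu_neq0.
have CD0 : C *m (col_mx C u)^T = 0 by rewrite tr_col_mx mul_mx_row CC0 Cu0 row_mx0.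
have ltCD : (C < col_mx C u)%MS.
  rewrite ltmxE -!addsmxE addsmxSl addsmx_sub submx_refl /=.
  apply: contra uu_neq0 => /submxP[w ->].
  by rewrite trmx_mul mulmxA -(mulmxA w) CC0 mulmx0 mul0mx.
move/rank_ltmx: ltCD; move/mulmx0_rank_max: CD0; rewrite mxrank_tr; lia.
Qed.

(** Integral row operations, invertible modulo [p], make all rows of [A] beyond
    the first [d], its rank modulo [p], divisible by [p]. This takes out a
    factor [p ^ (v - d)] on each side of the Gram matrix. *)
Lemma dvdz_det_gram (p v b : nat) (A : 'M[int]_(v, b)) : prime p ->
  ((p ^ (v - \rank (map_mx intr A : 'M['F_p]_(v, b))).*2)%N %| \det (A *m A^T))%Z.
Proof.
move=> pr_p; set Ap := map_mx intr A; set d := \rank Ap.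
have dvd_p (m : int) : (p %| m)%Z = (m%:~R == 0 :> 'F_p).
  exact: dvdz_pcharf (pchar_Fp pr_p) m.
(* An integral lift of Gaussian elimination over ['F_p]. *)
pose U : 'M[int]_v :=
  map_mx (fun c : 'F_p => (c : nat)%:Z) (invmx (col_ebase Ap)).
have mapU : map_mx intr U = invmx (col_ebase Ap).
  by apply/matrixP=> i j; rewrite !mxE -pmulrn natr_Zp.
have coprime_detU : coprimez (p ^ (v - d).*2)%N (\det U).
  rewrite coprimezE /= coprimeXl // prime_coprime //.
  have := dvd_p (\det U); rewrite dvdzE /= => ->.
  by rewrite -det_map_mx mapU -unitfE -unitmxE unitmx_inv col_ebase_unit.
have low_rows (i : 'I_v) j : ~~ (i < d)%N -> (p %| (U *m A) i j)%Z.
  move=> le_d_i; rewrite dvd_p.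
  have -> : ((U *m A) i j)%:~R = (map_mx intr (U *m A)) i j :> 'F_p by rewrite [RHS]mxE.
  rewrite map_mxM mapU -/Ap -{2}(mulmx_ebase Ap) !mulmxA mulVmx ?col_ebase_unit //.
  rewrite mul1mx mxE big1 // => k _.
  by rewrite mxE -/d (negPf le_d_i) andbF mul0r.
pose D : 'rV[int]_v := \row_i (if (i < d)%N then 1 else p%:Z).
pose M : 'M[int]_(v, b) := \matrix_(i, j)
  (if (i < d)%N then (U *m A) i j else ((U *m A) i j %/ p)%Z).
have UA : U *m A = diag_mx D *m M.
  apply/matrixP=> i j; rewrite mul_diag_mx [RHS]mxE [M i j]mxE [D _ _]mxE.
  case: ifPn => [|le_d_i]; first by rewrite mul1r.
  by rewrite mulrC divzK // low_rows.
have detD : \det (diag_mx D) = (p ^ (v - d))%N.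
  rewrite det_diag (eq_bigr (fun i : 'I_v => if ~~ (i < d)%N then p%:Z else 1)); last first.
    by move=> i _; rewrite mxE if_neg.
  rewrite -big_mkcond /= -(big_mkord (fun i => ~~ (i < d)%N) (fun _ => p%:Z)).
  have le_dv : (d <= v)%N by exact: rank_leq_row.
  rewrite (big_cat_nat (leq0n d) le_dv) /= big_nat_cond big1 ?mul1r; last first.
    by move=> i /andP[] /andP[_ ->].
  rewrite big_nat_cond (eq_bigl (fun i => (d <= i < v)%N)); last first.
    by move=> i /=; lia.
  by rewrite -big_nat prodr_const_nat -!natz natrX.
have -> : (p ^ (v - d).*2)%N = (p ^ (v - d))%N%:Z * (p ^ (v - d))%N%:Z :> int.
  by rewrite -addnn expnD PoszM.
rewrite -detD.
have : \det U * (\det U * \det (A *m A^T)) =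
  \det (diag_mx D) * \det (diag_mx D) * \det (M *m M^T).
  have := congr1 (fun X => \det (X *m X^T)) UA.
  rewrite !trmx_mul !mulmxA -(mulmxA U) -(mulmxA (diag_mx D)) !det_mulmx !det_tr.
  by move: (\det _) (\det (A *m _)) (\det (diag_mx D)) (\det (M *m _)) => x y z t; lia.
rewrite detD -PoszM -expnD addnn => detE.
rewrite -(Gauss_dvdzr _ coprime_detU) -(Gauss_dvdzr _ coprime_detU) detE.
by rewrite dvdz_mulr.
Qed.

(** The all-one vector and the unit vectors [e_1, ..., e_n] form a basis, the
    columns of the unitriangular matrix [P]. The all-one vector is an
    eigenvector for [a + (n + 1) c], and [e_j] goes to [a e_j] plus [c] times
    the all-one vector, so the matrix becomes the upper triangular [T]. *)
Lemma det_scalar_plus_const (R : comNzRingType) (n : nat) (a c : R) :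
  \det (a%:M + const_mx c : 'M_n.+1) = a ^+ n * (a + c *+ n.+1).
Proof.
pose P : 'M[R]_n.+1 := \matrix_(i, j) ((j == i) || (j == ord0))%:R.
pose T : 'M[R]_n.+1 := \matrix_(i, j)
  (if j == ord0 then (a + c *+ n.+1) *+ (i == ord0) else a *+ (i == j) + c *+ (i == ord0)).
have detP : \det P = 1.
  rewrite det_trig; last first.
    apply/is_trig_mxP => i j lt_ij; rewrite mxE.
    case: eqP lt_ij => [->|_]; first by rewrite ltnn.
    by case: eqP => // ->.
  by rewrite big1 // => i _; rewrite mxE eqxx.
have detT : \det T = a ^+ n * (a + c *+ n.+1).
  rewrite -det_tr det_trig; last first.
    apply/is_trig_mxP => i j lt_ij; rewrite !mxE.
    have /negPf-> : j != ord0 by rewrite -val_eqE /=; lia.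
    case: eqP => // _; have /negPf-> : j != i by rewrite -val_eqE /=; lia.
    by rewrite addr0.
  rewrite big_ord_recl !mxE eqxx mulrC; congr (_ * _).
  rewrite (eq_bigr (fun=> a)); first by rewrite prodr_const card_ord.
  by move=> i _; rewrite !mxE /= eqxx addr0.
rewrite -[LHS]mulr1 -detP -det_mulmx -detT -[RHS]mul1r -detP -det_mulmx.
congr (\det _); apply/matrixP=> i j.
have sumP : \sum_k P k j = (if j == ord0 then n.+1 else 1)%:R.
  case: eqP => [-> | /eqP/negPf j0].
    rewrite (eq_bigr (fun=> 1)); first by rewrite sumr_const card_ord.
    by move=> k _; rewrite mxE eqxx orbT.
  rewrite (bigD1 j) //= mxE eqxx big1 ?addr0 // => k neq_kj.
  by rewrite mxE j0 orbF eq_sym (negPf neq_kj).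
have -> : ((a%:M + const_mx c) *m P) i j = a * P i j + c * \sum_k P k j.
  rewrite mulmxDl mxE mul_scalar_mx mxE [X in _ + X]mxE mulr_sumr.
  by congr (_ + _); apply: eq_bigr => k _; rewrite mxE.
rewrite sumP [RHS]mxE (bigD1 ord0) //= !mxE eqxx orbT mul1r /= mulr1n.
case: (eqVneq j ord0) => [-> | j0].
  rewrite orbT mulr1 mulr_natr big1 ?addr0 // => k k0.
  by rewrite !mxE eqxx (negPf k0) mulr0n mulr0.
rewrite orbF mulr1 mulr0n add0r mulr1n addrC; congr (_ + _).
case: (eqVneq i j) => [-> | neq_ij].
  rewrite (bigD1 j) //= !mxE !eqxx (negPf j0) mul1r addr0 big1 ?addr0 ?mulr1 // => k /andP[k0 kj].
  by rewrite !mxE (negPf kj) (negPf k0) mul0r.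
rewrite mulr0 big1 // => k k0; rewrite !mxE (negPf j0) (negPf k0) addr0 orbF.
by case: (eqVneq k i) => [-> | _]; rewrite ?mul0r // (negPf neq_ij) mulr0.
Qed.

Local Close Scope ring_scope.

Lemma sum_mem_card (J T : finType) (f : J -> T) (A : {set T}) :
  bijective f -> \sum_j (f j \in A) = #|A|.
Proof.
move=> bij_f; rewrite -sum1_card [RHS]big_mkcond (reindex f) //.
exact: onW_bij.
Qed.

(** Double counting of the pairs [(s, i)] with [s != q] and both [q] and [s] in
    [B i]. *)
Lemma replication_number (v k lambda : nat) (T I : finType)
    (B : I -> {set T}) (q : T) :
  block_design v k lambda B ->
  #|[set i | q \in B i]| * k.-1 = lambda * v.-1.
Proof.
move=> [cardT cardB pairB].
have bij_id (J : finType) : bijective (@id J) by exists id.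
have <- : \sum_(s | s != q) \sum_i ((q \in B i) && (s \in B i)) = lambda * v.-1.
  rewrite (eq_bigr (fun=> lambda)) => [|s neq_sq].
    by rewrite sum_nat_const -cardT (cardC1 q) mulnC.
  rewrite -(pairB q s) 1?eq_sym // -(sum_mem_card _ (bij_id _)) /=.
  by apply: eq_bigr => i _; rewrite inE.
rewrite exchange_big /= -sum_nat_const big_mkcond /=; apply: eq_bigr => i _.
rewrite inE; case: ifP => qBi /=; last by rewrite big1.
by rewrite -(cardB i) -(sum_mem_card _ (bij_id _)) /= [in LHS](bigD1 q) //= qBi.
Qed.

Local Open Scope ring_scope.

(** The two estimates of the rank modulo [p] of the incidence matrix, combined.
    Here [a] stands for [r - lambda], where [r] is the replication number, and
    the condition on [a] is [r (k - 1) = lambda (v - 1)]. In the last condition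
    [i = j] is included: it says that [p] divides the size of each block. *)
Lemma block_design_pdivisibility (n k lambda a p : nat) (T I : finType)
    (B : I -> {set T}) :
  block_design n.+1 k lambda B -> (1 < k)%N ->
  ((a + lambda) * k.-1 = lambda * n)%N ->
  prime p -> ~~ (p %| n.+1)%N ->
  (forall i j, (p %| #|B i :&: B j|)%N) ->
  (p ^ (n.+1 - n./2).*2 %| a ^ n * (a + lambda * n.+1))%N.
Proof.
move=> desB k_gt1 aE pr_p p'v p_dvd_meet.
have [cardT cardB pairB] := desB.
pose pt (x : 'I_n.+1) : T := enum_val (cast_ord (esym cardT) x).
have bij_pt : bijective pt.
  apply: bij_comp (enum_val_bij _) _.
  by exists (cast_ord cardT) => x; rewrite ?cast_ordK ?cast_ordKV.
pose N : 'M[int]_(n.+1, #|I|) := \matrix_(x, i) (pt x \in B (enum_val i))%:R.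
have gramN : N *m N^T = a%:R%:M + const_mx lambda%:R.
  apply/matrixP=> x y; rewrite !mxE.
  pose Bxy := [set i | (pt x \in B i) && (pt y \in B i)].
  rewrite (eq_bigr (fun i : 'I_#|I| => (enum_val i \in Bxy)%:R)).
    rewrite -natr_sum (sum_mem_card _ (enum_val_bij _)) {}/Bxy.
    have [<-{y} | neq_xy] := eqVneq x y; last first.
      by rewrite add0r pairB ?(inj_eq (bij_inj bij_pt)).
    rewrite -natrD; congr _%:R; apply/eqP.
    have k1_gt0 : (0 < k.-1)%N by lia.
    rewrite -(eqn_pmul2r k1_gt0) aE -(replication_number (pt x) desB).
    by apply/eqP; congr (_ * _)%N; apply: eq_card => i; rewrite !inE andbb.
  by move=> i _; rewrite !mxE inE -natrM mulnb.
have charp := pchar_Fp pr_p.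
pose C : 'M['F_p]_(#|I|, n.+1) := (map_mx intr N)^T.
have CE i x : C i x = (pt x \in B (enum_val i))%:R by rewrite !mxE rmorph_nat.
have CC0 : C *m C^T = 0.
  apply/matrixP=> i j; rewrite [RHS]mxE mxE.
  rewrite (eq_bigr (fun x => (pt x \in B (enum_val i) :&: B (enum_val j))%:R)).
    rewrite -natr_sum (sum_mem_card _ bij_pt).
    apply/eqP; rewrite -(dvdn_pcharf charp).
    exact: p_dvd_meet.
  by move=> x _; rewrite [C^T _ _]mxE !CE -natrM mulnb inE.
pose u : 'rV['F_p]_n.+1 := const_mx 1.
have Cu0 : C *m u^T = 0.
  apply/matrixP=> i j; rewrite [RHS]mxE mxE.
  rewrite (eq_bigr (fun x => (pt x \in B (enum_val i))%:R)).
    rewrite -natr_sum (sum_mem_card _ bij_pt).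
    apply/eqP; rewrite -(dvdn_pcharf charp).
    by have := p_dvd_meet (enum_val i) (enum_val i); rewrite setIid.
  by move=> x _; rewrite !mxE mulr1 rmorph_nat.
have uu_neq0 : u *m u^T != 0.
  apply: (contraNneq _ p'v) => /matrixP/(_ ord0 ord0).
  rewrite !mxE (eq_bigr (fun=> 1)) => [|x _]; last by rewrite !mxE mulr1.
  by rewrite sumr_const card_ord => /eqP; rewrite -(dvdn_pcharf charp).
have := rank_self_orthogonal_in_hyperplane CC0 Cu0 uu_neq0.
rewrite /C mxrank_tr => lt_rank.
have := dvdz_det_gram N pr_p.
rewrite gramN det_scalar_plus_const -mulrnA -natrD -natrX -natrM !pmulrn !intz dvdzE /=.
by apply: dvdn_trans; rewrite dvdn_exp2l // leq_double leq_sub2l // geq_half_double.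
Qed.

Local Close Scope ring_scope.

(** For [v = 56] and [p = 3] the determinant would be divisible by [3 ^ 58]
    while its two factors contribute only [55 + 2] factors 3. *)
Lemma no_design_with_meets_divisible_by_3 (k lambda a : nat) (T I : finType)
    (B : I -> {set T}) :
  block_design 56 k lambda B -> 1 < k -> (a + lambda) * k.-1 = lambda * 55 ->
  logn 3 a = 1 -> logn 3 (a + lambda * 56) = 2 ->
  ~ (forall i j, 3 %| #|B i :&: B j|).
Proof.
move=> desB k_gt1 aE log_a log_aL meet3.
have := block_design_pdivisibility desB k_gt1 aE (isT : prime 3) isT meet3.
have a_gt0 : 0 < a by rewrite lt0n; apply: contra_eq_neq log_a => ->.
rewrite pfactor_dvdn //; last by rewrite muln_gt0 expn_gt0 addn_gt0 a_gt0.
(* What remains is [58 <= 55 * 1 + 2]. *)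
by rewrite lognM ?expn_gt0 ?addn_gt0 ?a_gt0 // lognX log_a log_aL.
Qed.

Lemma quasi_symmetric_meet_dvd (v k lambda x y d : nat) (T I : finType)
    (B : I -> {set T}) :
  quasi_symmetric_design v k lambda x y B -> d %| k -> d %| x -> d %| y ->
  forall i j, d %| #|B i :&: B j|.
Proof.
move=> [[_ cardB _] _ meetB _ _] dk dx dy i j.
have [<- | /meetB[] -> //] := eqVneq i j.
by rewrite setIid cardB.
Qed.

Theorem mainTheorem5 :
  (~ exists (T I : finType) (B : I -> {set T}),
       quasi_symmetric_design 56 15 42 3 6 B) /\
  (~ exists (T I : finType) (B : I -> {set T}),
       quasi_symmetric_design 56 21 24 6 9 B).
Proof.
(* The numbers 123 and 42 are the values of [r - lambda]. *)
split=> -[T [I [B qsB]]].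
  have [desB _ _ _ _] := qsB.
  apply: (@no_design_with_meets_divisible_by_3 15 42 123 _ _ _ desB) => //.
  exact: quasi_symmetric_meet_dvd qsB _ _ _.
have [desB _ _ _ _] := qsB.
apply: (@no_design_with_meets_divisible_by_3 21 24 42 _ _ _ desB) => //.
exact: quasi_symmetric_meet_dvd qsB _ _ _.
Qed.
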